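(* Let $f,\psi_0,\phi:\mathbb R^p\to\mathbb R$ be directionally differentiable and such that $\mathbf\Delta_{\psi_0}(\cdot,\gamma)$ and $\mathbf\Delta_\phi(\cdot,\gamma)$ are directionally differentiable for every $\gamma$. Let $\mu_0\ge0$, let $\rho_t>0$ ($t\ge0$) be any positive sequence, let $\theta_0\in(0,1]$, and let $\theta_t\in(0,1]$ for $t\ge1$ be determined by $$\frac{\theta_t^2}{1-\theta_t}=\frac{\theta_{t-1}(\rho_{t-1}\theta_{t-1}+\mu_0)}{\rho_t},\qquad t\ge1.$$ Starting from $\alpha^{(0)}=\beta^{(0)}$, let the sequences satisfy, for $t\ge0$, $$\gamma^{(t)}=(1-\theta_t)\beta^{(t)}+\theta_t\alpha^{(t)},$$ $$\alpha^{(t+1)}\in\mathop{\arg\min}_\beta\ f(\beta)-\mathbf\Delta_{\psi_0}(\beta,\gamma^{(t)})+\mu_0\mathbf\Delta_\phi(\beta,\gamma^{(t)})+\theta_t\rho_t\mathbf\Delta_\phi(\beta,\alpha^{(t)}),$$ $$\beta^{(t+1)}=(1-\theta_t)\beta^{(t)}+\theta_t\alpha^{(t+1)}.$$ Let $\bar\psi_0=\psi_0-\mu_0\phi$, $$R_t=\theta_t^2\rho_t\mathbf\Delta_\phi(\alpha^{(t+1)},\alpha^{(t)})-\mathbf\Delta_{\bar\psi_0}(\beta^{(t+1)},\gamma^{(t)})+(1-\theta_t)\mathbf\Delta_{\bar\psi_0}(\beta^{(t)},\gamma^{(t)})+\mathbf C_{f(\cdot)-\mathbf\Delta_{\bar\psi_0}(\cdot,\gamma^{(t)})}(\alpha^{(t+1)},\beta^{(t)},\theta_t),$$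 $$\mathcal E_t(\beta)=\mathbf\Delta_{\bar\psi_0}(\beta,\gamma^{(t)})+\mathbf\Delta_{f(\cdot)-\mathbf\Delta_{\psi_0}(\cdot,\gamma^{(t)})}(\beta,\alpha^{(t+1)})+\big(\mu_0\mathbf\Delta_{\mathbf\Delta_\phi(\cdot,\gamma^{(t)})-\phi(\cdot)}+\theta_t\rho_t\mathbf\Delta_{\mathbf\Delta_\phi(\cdot,\alpha^{(t)})-\phi(\cdot)}\big)(\beta,\alpha^{(t+1)}).$$ (i) When $\mu_0=0$, for any $\beta$ and $T\ge0$, $$\frac{f(\beta^{(T+1)})-f(\beta)}{\theta_T^2\rho_T}+\sum_{t=0}^T\frac{\mathcal E_t(\beta)}{\theta_t\rho_t}+\sum_{t=0}^T\frac{R_t}{\theta_t^2\rho_t}\le\mathbf\Delta_\phi(\beta,\alpha^{(0)})-\mathbf\Delta_\phi(\beta,\alpha^{(T+1)})+\frac{1-\theta_0}{\theta_0^2\rho_0}\big[f(\beta^{(0)})-f(\beta)\big].$$ (ii) Moreover, given any $\mu_0\ge0$, for all $\beta$ and $T\ge0$, $$f(\beta^{(T+1)})-f(\beta)+\theta_T^2\Big(\rho_T+\frac{\mu_0}{\theta_T}\Big)\mathbf\Delta_\phi(\beta,\alpha^{(T+1)})+\sum_{t=0}^T\Big(\prod_{s=t+1}^T(1-\theta_s)\Big)\big(R_t+\theta_t\mathcal E_t(\beta)\big)$$ $$\le\Big(\prod_{t=1}^T(1-\theta_t)\Big)\Big[(1-\theta_0)(f(\beta^{(0)})-f(\beta))+\theta_0^2\rho_0\mathbf\Delta_\phi(\beta,\beta^{(0)})\Big],$$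 where by convention an empty product equals $1$.
   Context: For $\psi:\mathbb R^p\to\mathbb R$, $\delta\psi(\beta;h)=\lim_{\epsilon\to0+}[\psi(\beta+\epsilon h)-\psi(\beta)]/\epsilon$; $\psi$ is directionally differentiable if this limit exists and is finite for all $\beta,h$. The generalized Bregman function is $\mathbf\Delta_\psi(\beta,\gamma)=\psi(\beta)-\psi(\gamma)-\delta\psi(\gamma;\beta-\gamma)$; a notation such as $\mathbf\Delta_{\mathbf\Delta_\phi(\cdot,\gamma)-\phi(\cdot)}$ is the generalized Bregman function of the function $\beta\mapsto\mathbf\Delta_\phi(\beta,\gamma)-\phi(\beta)$. For $0\le\theta\le1$, $\mathbf C_\psi(\alpha,\beta,\theta)=\theta\psi(\alpha)+(1-\theta)\psi(\beta)-\psi(\theta\alpha+(1-\theta)\beta)$. No convexity or smoothness is assumed. *)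

(* Defs.v *)
From HB Require Import structures.
From mathcomp Require Import all_boot all_order all_algebra.
From mathcomp Require Import all_classical all_reals all_analysis.

Set Implicit Arguments.
Unset Strict Implicit.
Unset Printing Implicit Defensive.

Import Order.TTheory GRing.Theory Num.Theory.
Import numFieldNormedType.Exports.

Local Open Scope classical_set_scope.
Local Open Scope ring_scope.

Definition dir_quotient (R : realType) (p : nat) (psi : 'rV[R]_p -> R)
  (b h : 'rV[R]_p) (e : R) : R := (psi (b + e *: h) - psi b) / e.

(* The limit is one-sided, unlike the library's 'D_h psi b; the value is only
   meaningful when the limit exists. *)
Definition dir_deriv (R : realType) (p : nat) (psi : 'rV[R]_p -> R)
  (b h : 'rV[R]_p) : R := lim (dir_quotient psi b h e @[e --> 0^'+]).

(* Convergence takes place in R, so the limit is finite. *)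
Definition dir_differentiable (R : realType) (p : nat)
  (psi : 'rV[R]_p -> R) : Prop :=
  forall b h : 'rV[R]_p, cvg (dir_quotient psi b h e @[e --> 0^'+]).

Definition gbregman (R : realType) (p : nat) (psi : 'rV[R]_p -> R)
  (b g : 'rV[R]_p) : R := psi b - psi g - dir_deriv psi g (b - g).

Definition cvx_gap (R : realType) (p : nat) (psi : 'rV[R]_p -> R)
  (a b : 'rV[R]_p) (theta : R) : R :=
  theta * psi a + (1 - theta) * psi b - psi (theta *: a + (1 - theta) *: b).

Definition argmin (R : realType) (p : nat) (F : 'rV[R]_p -> R) :
  set 'rV[R]_p := [set a | forall b, F a <= F b].

(* Main.v *)
Require Import Defs.
From HB Require Import structures.
From mathcomp Require Import all_boot all_order all_algebra.
From mathcomp Require Import all_classical all_reals all_analysis.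
From mathcomp Require Import ring lra.

Set Implicit Arguments.
Unset Strict Implicit.
Unset Printing Implicit Defensive.

Import Order.TTheory GRing.Theory Num.Theory.
Import numFieldNormedType.Exports.

Local Open Scope classical_set_scope.
Local Open Scope ring_scope.

(* At a minimizer a of F, F b - F a dominates the generalized Bregman function
   of F at (b, a). Applied to the subproblem defining alpha^(t+1), multiplied by
   theta_t, and rewritten with C_g (alpha^(t+1), beta^(t), theta_t), where
   g = f - Delta_bpsi0(., gamma^(t)), this gives the one-step inequality
     f(beta^(t+1)) - f(b) + theta_t^2 (rho_t + mu0/theta_t) D(alpha^(t+1))
       + R_t + theta_t E_t(b)
     <= (1 - theta_t) (f(beta^(t)) - f(b)) + theta_t^2 rho_t D(alpha^(t))
   with D = Delta_phi(b, .). The recursion on theta says exactly that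
   theta_{t+1}^2 rho_{t+1} = (1 - theta_{t+1}) theta_t^2 (rho_t + mu0/theta_t),
   so the one-step inequalities chain, which gives (ii); dividing them by
   theta_t^2 rho_t makes them telescope when mu0 = 0, which gives (i). *)

Lemma dir_quotientDZ (R : realType) (p : nat) (u v : 'rV[R]_p -> R) (c : R)
  (b h : 'rV[R]_p) :
  dir_quotient (fun x => u x + c * v x) b h
  = (fun e => dir_quotient u b h e + c * dir_quotient v b h e).
Proof. by apply/funext => e; rewrite /dir_quotient /=; ring. Qed.

Lemma dir_differentiableDZ (R : realType) (p : nat) (u v : 'rV[R]_p -> R)
  (c : R) :
  dir_differentiable u -> dir_differentiable v ->
  dir_differentiable (fun x => u x + c * v x).
Proof.
move=> du dv b h; rewrite dir_quotientDZ.
by apply: is_cvgD; [exact: du|apply: is_cvgM; [exact: is_cvg_cst|exact: dv]].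
Qed.

(** [lim] is additive only where both one-sided limits exist, hence the two differentiability
    hypotheses. *)
Lemma gbregmanDZ (R : realType) (p : nat) (u v : 'rV[R]_p -> R) (c : R)
  (b g : 'rV[R]_p) :
  dir_differentiable u -> dir_differentiable v ->
  gbregman (fun x => u x + c * v x) b g = gbregman u b g + c * gbregman v b g.
Proof.
move=> du dv; rewrite /gbregman /dir_deriv dir_quotientDZ.
rewrite (cvg_lim _ (cvgD (du g (b - g)) (cvgM (cvg_cst c) (dv g (b - g)))))//.
by ring.
Qed.

Lemma gbregmanB (R : realType) (p : nat) (u v : 'rV[R]_p -> R)
  (b g : 'rV[R]_p) :
  dir_differentiable u -> dir_differentiable v ->
  gbregman (fun x => u x - v x) b g = gbregman u b g - gbregman v b g.
Proof.
move=> du dv; rewrite -mulN1r -gbregmanDZ//; congr (gbregman _ b g).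
by apply/funext => x; rewrite mulN1r.
Qed.

Lemma dir_differentiableB (R : realType) (p : nat) (u v : 'rV[R]_p -> R) :
  dir_differentiable u -> dir_differentiable v ->
  dir_differentiable (fun x => u x - v x).
Proof.
move=> du dv; rewrite (_ : (fun x => _) = (fun x => u x + (-1) * v x)).
  exact: dir_differentiableDZ.
by apply/funext => x; rewrite mulN1r.
Qed.

(* First-order optimality without convexity: the one-sided derivative at a
   minimizer is nonnegative in every direction. *)
Lemma gbregman_argmin (R : realType) (p : nat) (F : 'rV[R]_p -> R)
  (a b : 'rV[R]_p) :
  dir_differentiable F -> argmin F a -> gbregman F b a <= F b - F a.
Proof.
move=> dF minF; rewrite /gbregman lerBlDr lerDl.
apply: limr_ge; first exact: dF.
near=> e; rewrite /dir_quotient divr_ge0 ?subr_ge0//; exact: minF.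
Unshelve. all: by end_near.
Qed.

Theorem theorem6 (R : realType) (p : nat)
  (f psi0 phi : 'rV[R]_p -> R)
  (f_dd : dir_differentiable f)
  (psi0_dd : dir_differentiable psi0)
  (phi_dd : dir_differentiable phi)
  (Dpsi0_dd : forall g, dir_differentiable (fun x => gbregman psi0 x g))
  (Dphi_dd : forall g, dir_differentiable (fun x => gbregman phi x g))
  (mu0 : R) (mu0_ge0 : 0 <= mu0)
  (rho : nat -> R) (rho_gt0 : forall t, 0 < rho t)
  (theta : nat -> R) (theta_in : forall t, 0 < theta t <= 1)
  (theta_rec : forall t,
     theta t.+1 ^+ 2 / (1 - theta t.+1)
     = theta t * (rho t * theta t + mu0) / rho t.+1)
  (alpha beta gamma : nat -> 'rV[R]_p)
  (init : alpha 0%N = beta 0%N)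
  (gammaE : forall t,
     gamma t = (1 - theta t) *: beta t + theta t *: alpha t)
  (alphaE : forall t,
     argmin (fun x => f x - gbregman psi0 x (gamma t)
                      + mu0 * gbregman phi x (gamma t)
                      + theta t * rho t * gbregman phi x (alpha t))
            (alpha t.+1))
  (betaE : forall t,
     beta t.+1 = (1 - theta t) *: beta t + theta t *: alpha t.+1) :
  let bpsi0 := fun x => psi0 x - mu0 * phi x in
  let Rem := fun t : nat =>
    theta t ^+ 2 * rho t * gbregman phi (alpha t.+1) (alpha t)
    - gbregman bpsi0 (beta t.+1) (gamma t)
    + (1 - theta t) * gbregman bpsi0 (beta t) (gamma t)
    + cvx_gap (fun x => f x - gbregman bpsi0 x (gamma t))
        (alpha t.+1) (beta t) (theta t) in
  let Err := fun (t : nat) (b : 'rV[R]_p) =>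
    gbregman bpsi0 b (gamma t)
    + gbregman (fun x => f x - gbregman psi0 x (gamma t)) b (alpha t.+1)
    + (mu0 * gbregman (fun x => gbregman phi x (gamma t) - phi x)
               b (alpha t.+1)
       + theta t * rho t
         * gbregman (fun x => gbregman phi x (alpha t) - phi x)
             b (alpha t.+1)) in
  (mu0 = 0 ->
   forall (b : 'rV[R]_p) (T : nat),
     (f (beta T.+1) - f b) / (theta T ^+ 2 * rho T)
     + \sum_(0 <= t < T.+1) Err t b / (theta t * rho t)
     + \sum_(0 <= t < T.+1) Rem t / (theta t ^+ 2 * rho t)
     <= gbregman phi b (alpha 0%N) - gbregman phi b (alpha T.+1)
        + (1 - theta 0%N) / (theta 0%N ^+ 2 * rho 0%N)
          * (f (beta 0%N) - f b))
  /\
  (forall (b : 'rV[R]_p) (T : nat),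
     f (beta T.+1) - f b
     + theta T ^+ 2 * (rho T + mu0 / theta T) * gbregman phi b (alpha T.+1)
     + \sum_(0 <= t < T.+1)
         (\prod_(t.+1 <= s < T.+1) (1 - theta s))
         * (Rem t + theta t * Err t b)
     <= (\prod_(1 <= t < T.+1) (1 - theta t))
        * ((1 - theta 0%N) * (f (beta 0%N) - f b)
           + theta 0%N ^+ 2 * rho 0%N * gbregman phi b (beta 0%N))).
Proof.
move=> bpsi0 Rem Err.
have th0 t : 0 < theta t by case/andP: (theta_in t).
have bpsi0E b g :
    gbregman bpsi0 b g = gbregman psi0 b g - mu0 * gbregman phi b g.
  rewrite /bpsi0 -mulNr -gbregmanDZ//; congr (gbregman _ b g).
  by apply/funext => x; rewrite mulNr.
have step b t :
    f (beta t.+1) - f b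
    + theta t ^+ 2 * (rho t + mu0 / theta t) * gbregman phi b (alpha t.+1)
    + (Rem t + theta t * Err t b)
    <= (1 - theta t) * (f (beta t) - f b)
       + theta t ^+ 2 * rho t * gbregman phi b (alpha t).
  have d1 := dir_differentiableB f_dd (Dpsi0_dd (gamma t)).
  have d2 := dir_differentiableDZ (c := mu0) d1 (Dphi_dd (gamma t)).
  have d3 := dir_differentiableDZ (c := theta t * rho t) d2 (Dphi_dd (alpha t)).
  have := gbregman_argmin b d3 (alphaE t).
  rewrite !gbregmanDZ// -subr_ge0 => /(mulr_ge0 (ltW (th0 t))).
  (* The slack of the goal equals [theta t] times the slack of the optimality inequality, so an
     identity remains. *)
  rewrite -[in X in _ -> X]subr_ge0; congr (_ <= _).
  rewrite /Rem /Err /cvx_gap (addrC (theta t *: alpha t.+1)) -betaE.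
  (* The [- phi] parts of [Err] account for the term in [gbregman phi b (alpha t.+1)], since [theta
     * (mu0 + theta * rho) = theta^2 * (rho + mu0 / theta)]. *)
  rewrite !(gbregmanB _ _ (Dphi_dd _) phi_dd) !bpsi0E.
  by field; rewrite gt_eqF.
have recE t : theta t.+1 ^+ 2 * rho t.+1
    = (1 - theta t.+1) * (theta t ^+ 2 * (rho t + mu0 / theta t)).
  have th1 : 1 - theta t.+1 != 0.
    (* division by zero would make the left side of the recursion vanish *)
    apply/eqP => E; have := theta_rec t; rewrite E invr0 mulr0 => /esym/eqP.
    rewrite gt_eqF// divr_gt0// mulr_gt0// ltr_wpDr//.
    by rewrite mulr_gt0.
  have -> : theta t.+1 ^+ 2 =
      theta t.+1 ^+ 2 / (1 - theta t.+1) * (1 - theta t.+1).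
    by rewrite divfK.
  by rewrite theta_rec; field; rewrite !gt_eqF.
split=> [mu00 b T|b T].
- have stepi t : (f (beta t.+1) - f b) / (theta t ^+ 2 * rho t)
      + Err t b / (theta t * rho t) + Rem t / (theta t ^+ 2 * rho t)
      <= (1 - theta t) / (theta t ^+ 2 * rho t) * (f (beta t) - f b)
         + (gbregman phi b (alpha t) - gbregman phi b (alpha t.+1)).
    have c0 : 0 <= (theta t ^+ 2 * rho t)^-1.
      by rewrite invr_ge0 mulr_ge0// ?ltW// exprn_gt0.
    have := step b t; rewrite mu00 mul0r addr0 -subr_ge0 => /(mulr_ge0 c0).
    rewrite -[in X in _ -> X]subr_ge0; congr (_ <= _).
    by field; rewrite !gt_eqF.
  elim: T => [|T IH].
    by rewrite !big_nat1 (le_trans (stepi 0%N))// addrC.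
  rewrite !(big_nat_recr T.+1)//=.
  have := lerD IH (stepi T.+1).
  (* With equal coefficients, the gaps [f (beta T.+1) - f b] cancel between [IH] and the new
     step. *)
  have -> : (1 - theta T.+1) / (theta T.+1 ^+ 2 * rho T.+1)
      = (theta T ^+ 2 * rho T)^-1.
    have := recE T; rewrite mu00 mul0r addr0 => E.
    have : theta T.+1 ^+ 2 * rho T.+1 != 0.
      by rewrite gt_eqF// mulr_gt0// exprn_gt0.
    rewrite E mulf_eq0 negb_or => /andP[h1 h2].
    by rewrite invfM mulrA divff// mul1r.
  by lra.
- elim: T => [|T IH].
    by rewrite big_nat1 !big_geq// !mul1r; have := step b 0%N; rewrite init.
  (* [IH] is to be multiplied by this factor, which may not be negative. *)
  have le1 : 0 <= 1 - theta T.+1 by rewrite subr_ge0; case/andP: (theta_in T.+1).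
  rewrite big_nat_recr//= [X in _ + (_ + X)](_ : _ =
    Rem T.+1 + theta T.+1 * Err T.+1 b); last first.
    by rewrite big_geq// mul1r.
  rewrite (big_nat_recr T.+1 1)//=.
  (* The newest weight is an empty product; every older one gains the factor [1 - theta T.+1], which
     leaves the sum as in the scaled [IH]. *)
  under eq_big_nat => t /andP[_ tT] do rewrite big_nat_recr//= -mulrA mulrCA.
  rewrite -mulr_sumr.
  have := lerD (ler_wpM2l le1 IH) (step b T.+1).
  (* By [recE] the terms in [gbregman phi b (alpha T.+1)] cancel. *)
  rewrite recE; set P := \prod_(_ <= _ < _) _; set S := \sum_(_ <= _ < _) _.
  by rewrite -subr_ge0 -[in X in _ -> X]subr_ge0; congr (_ <= _); ring.
Qed.
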